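(* Let $U\subseteq C^{r_{\mathcal F}}(\Omega,\mathbb{R}^c)\cap C^{r_{\mathcal B}}(\overline\Omega,\mathbb{R}^c)$. Consider finite collocation sets $\Omega^h=\{z_{\mathcal F}^i\}_{i=1}^{N_{\mathcal F}}\subset\Omega$ and $\Gamma^h=\{z_{\mathcal B}^j\}_{j=1}^{N_{\mathcal B}}\subset\Gamma$ with $N_{\mathcal F},N_{\mathcal B}\in\mathbb{N}$, and set $\ell:=N_{\mathcal F}(d+r_{\mathcal F})+N_{\mathcal B}(d+r_{\mathcal B})$. Let $\sigma\in C^{\ell-d}(\mathbb{R},\mathbb{R})$ satisfy $\sigma^{(k)}(a)\neq0$ for some $a\in\mathbb{R}$ and all $0\le k\le\ell-d$. Let $\mathcal H$ be the class of (restrictions to $\overline\Omega$ of) depth-$2$ neural networks $\mathbb{R}^d\to\mathbb{R}^c$ with activation $\sigma$ and arbitrary hidden-layer width, assume $\mathcal H\subseteq U$, and let $\mathcal H^M\subset\mathcal H$ be the subclass of those with $c\binom{\ell}{d}$ hidden units (i.e. $M=c\binom{\ell}{d}(d+1)+c\left(c\binom{\ell}{d}+1\right)$ parameters). If $\hat u\in U$ satisfies $\mathcal F(\hat u)(z)=0$ for all $z\in\Omega$ and $\mathcal B(\hat u)(z)=0$ for all $z\in\Gamma$, and if $\alpha_{\mathcal D}=0$, then there exists a one-hidden-layer neural network $u_\theta\in\mathcal H^M\subset\mathcal H$ such that $u_\theta$ solves $\min_{u\in\mathcal H}\mathcal J^h(u)$ and $\mathcal J^h(u_\theta)=0$.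
   Context: Setting. $d,c,c_{\mathcal F},c_{\mathcal B}\in\mathbb{N}$, $r_{\mathcal F},r_{\mathcal B}\in\mathbb{N}_0$, $\nu\in[1,\infty)$. $\Omega\subset\mathbb{R}^d$ is a bounded domain (open, connected) with Lipschitz boundary, $\Gamma\subseteq\partial\Omega$. $U$ is a Banach space of functions $\overline\Omega\to\mathbb{R}^c$, and $V$, $W$ are Banach spaces of functions $\Omega\to\mathbb{R}^{c_{\mathcal F}}$ and $\Gamma\to\mathbb{R}^{c_{\mathcal B}}$; $U,V,W$ are continuously embedded in $L^\nu(\Omega,\mathbb{R}^c)$, $L^\nu(\Omega,\mathbb{R}^{c_{\mathcal F}})$, $L^\nu(\Gamma,\mathbb{R}^{c_{\mathcal B}})$. The operators $\mathcal F:U\to V$ and $\mathcal B:U\to W$ are (possibly nonlinear) local differential operators of orders $r_{\mathcal F}$, $r_{\mathcal B}$: there are functions $F,B$ with $\mathcal F(u)(z)=F(z,\{D^\beta u(z):|\beta|\le r_{\mathcal F}\})$ for $z\in\Omega$ and $\mathcal B(u)(z)=B(z,\{D^\beta u(z):|\beta|\le r_{\mathcal B}\})$ for $z\in\Gamma$ (derivatives at boundary points are boundary values of the derivatives). AD-PINN functional. Let $\mathcal D^h\subseteq\Omega^h\cup\Gamma^h$ be the set of data locations, with given data $u^*(z)\in\mathbb{R}^c$, $z\in\mathcal D^h$; let $\alpha_{\mathcal F},\alpha_{\mathcal B},\alpha_{\mathcal D}\ge0$ and let $\omega_{\mathcal F}^z,\omega_{\mathcal B}^z,\omega_{\mathcal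 D}^z\ge0$ be quadrature weights (typically $1/|\Omega^h|$, $1/|\Gamma^h|$, $1/|\mathcal D^h|$). For $u\in U$, $$\mathcal J^h(u)=\alpha_{\mathcal F}\sum_{z\in\Omega^h}\omega_{\mathcal F}^z|\mathcal F(u)(z)|_\nu^\nu+\alpha_{\mathcal B}\sum_{z\in\Gamma^h}\omega_{\mathcal B}^z|\mathcal B(u)(z)|_\nu^\nu+\alpha_{\mathcal D}\sum_{z\in\mathcal D^h}\omega_{\mathcal D}^z|u(z)-u^*(z)|_\nu^\nu,$$ where $|\cdot|_\nu$ is the $\ell^\nu$-norm. ''Minimizer'' always means global minimizer. Neural networks. A depth-$2$ (one-hidden-layer) neural network with $m$ hidden units and activation $\sigma$ is a map $f(x)=W_2\,\sigma(W_1x+b_1)+b_2$ with $W_1\in\mathbb{R}^{m\times d}$, $b_1\in\mathbb{R}^m$, $W_2\in\mathbb{R}^{c\times m}$, $b_2\in\mathbb{R}^c$, $\sigma$ applied componentwise; all parameter values are allowed. *)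

(* Defs.v *)
From HB Require Import structures.
From mathcomp Require Import all_boot all_order all_algebra finmap.
From mathcomp Require Import all_classical all_reals all_analysis.

Set Implicit Arguments.
Unset Strict Implicit.
Unset Printing Implicit Defensive.

Import Order.TTheory GRing.Theory Num.Theory numFieldNormedType.Exports.

Local Open Scope classical_set_scope.
Local Open Scope ring_scope.

(* R^d is ['cV[R]_d].  A function on a set D is a total function whose values
   outside D are never used. *)

Definition lnorm (R : realType) (nu : R) (m : nat) (y : 'cV[R]_m) : R :=
  (\sum_(i < m) `|y i 0| `^ nu) `^ nu^-1.

(* The restriction of an outer measure to an arbitrary set D is again an outer
   measure; its Caratheodory measure is the measure induced by mu on D, whether
   or not D is itself mu-measurable. *)
Definition outer_restr (R : realType) (T : Type)
    (mu : {outer_measure set T -> \bar R}) (D : set T) (A : set T) : \bar R :=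
  mu (A `&` D).

Section OuterRestr.
Context (R : realType) (T : Type).
Context (mu : {outer_measure set T -> \bar R}) (D : set T).

Let restr0 : outer_restr mu D set0 = 0%E.
Proof. by rewrite /outer_restr set0I outer_measure0. Qed.

Let restr_ge0 A : (0 <= outer_restr mu D A)%E.
Proof. exact: outer_measure_ge0. Qed.

Let le_restr : {homo outer_restr mu D : A B / A `<=` B >-> (A <= B)%E}.
Proof. by move=> A B AB; apply: le_outer_measure; apply: setSI. Qed.

Let restr_sigma_subadditive : sigma_subadditive (outer_restr mu D).
Proof.
by move=> F; rewrite /outer_restr setI_bigcupl; apply: outer_measure_sigma_subadditive.
Qed.

HB.instance Definition _ := isOuterMeasure.Build R T (outer_restr mu D)
  restr0 restr_ge0 le_restr restr_sigma_subadditive.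

Definition induced_outer : {outer_measure set T -> \bar R} := outer_restr mu D.

End OuterRestr.

(* [mu_ext] takes the infimum over countable covers by measurable sets; on
   [g_sigma_algebraType setT] every set is measurable. *)
Definition cover_outer (R : realType) (T : pointedType)
    (g : set T -> \bar R) : set T -> \bar R :=
  mu_ext (g : set (g_sigma_algebraType [set: set T]) -> \bar R).

(* Volume of the smallest box containing A (+oo if A is unbounded). *)
Definition box_gauge (R : realType) (d : nat) (A : set 'cV[R]_d) : \bar R :=
  if A == set0 then 0%E else
  ereal_inf [set (\prod_(i < d) (p.2 i 0 - p.1 i 0))%:E |
    p in [set p : 'cV[R]_d * 'cV[R]_d |
      forall x, A x -> forall i, p.1 i 0 <= x i 0 <= p.2 i 0]].

Definition lebesgue_outer (R : realType) (d : nat) :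
    set 'cV[R]_d -> \bar R :=
  cover_outer (@box_gauge R d).

Definition diameter (R : realType) (d : nat) (A : set 'cV[R]_d) : \bar R :=
  ereal_sup [set (lnorm 2 (x - y))%:E | x in A & y in A].

Definition diam_gauge (R : realType) (d s : nat) (delta : R)
    (A : set 'cV[R]_d) : \bar R :=
  if A == set0 then 0%E
  else if (diameter A <= delta%:E)%E then (diameter A ^+ s)%E else +oo%E.

(* The s-dimensional Hausdorff measure, without the normalizing constant. *)
Definition hausdorff_outer (R : realType) (d s : nat) (A : set 'cV[R]_d) :
    \bar R :=
  ereal_sup [set cover_outer (diam_gauge s delta) A |
    delta in [set delta : R | 0 < delta]].

Section OuterMeasures.
Context (R : realType) (d : nat).

Section Cover.
Context (T : pointedType) (g : set T -> \bar R).
Hypotheses (g0 : g set0 = 0%E) (g_ge0 : forall A, (0 <= g A)%E).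

Lemma cover_outer0 : cover_outer g set0 = 0%E.
Proof. exact: mu_ext0. Qed.

Lemma cover_outer_ge0 A : (0 <= cover_outer g A)%E.
Proof. exact: mu_ext_ge0. Qed.

Lemma le_cover_outer : {homo cover_outer g : A B / A `<=` B >-> (A <= B)%E}.
Proof. by move=> A B AB; apply: (@le_mu_ext _ (g_sigma_algebraType setT)). Qed.

Lemma cover_outer_sigma_subadditive : sigma_subadditive (cover_outer g).
Proof. exact: (@mu_ext_sigma_subadditive _ (g_sigma_algebraType setT) R g g_ge0). Qed.

End Cover.

Lemma box_gauge0 : box_gauge (set0 : set 'cV[R]_d) = 0%E.
Proof. by rewrite /box_gauge eqxx. Qed.

Lemma box_gauge_ge0 (A : set 'cV[R]_d) : (0 <= box_gauge A)%E.
Proof.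
rewrite /box_gauge; case: ifPn => // /set0P[x Ax].
apply: le_ereal_inf_tmp => _ [p /= Ap <-]; rewrite lee_fin.
apply: prodr_ge0 => i _; rewrite subr_ge0.
by have /andP[] := Ap x Ax i; apply: le_trans.
Qed.

HB.instance Definition _ := isOuterMeasure.Build R 'cV[R]_d
  (@lebesgue_outer R d) (cover_outer0 box_gauge0 box_gauge_ge0)
  (cover_outer_ge0 box_gauge_ge0) (@le_cover_outer _ _)
  (cover_outer_sigma_subadditive box_gauge_ge0).

Context (s : nat).

Let diam_gauge0 delta : diam_gauge s delta (set0 : set 'cV[R]_d) = 0%E.
Proof. by rewrite /diam_gauge eqxx. Qed.

Let diam_gauge_ge0 delta (A : set 'cV[R]_d) : (0 <= diam_gauge s delta A)%E.
Proof.
rewrite /diam_gauge; case: ifPn => // /set0P[x Ax]; case: ifP => // _.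
apply: expe_ge0; apply: (@le_trans _ _ (lnorm 2 (x - x))%:E).
  by rewrite lee_fin powR_ge0.
by apply: ereal_sup_ubound; exists x => //; exists x.
Qed.

Let hausdorff0 : hausdorff_outer s (set0 : set 'cV[R]_d) = 0%E.
Proof.
rewrite /hausdorff_outer [X in ereal_sup X](_ : _ = [set 0%E]) ?ereal_sup1//.
apply/seteqP; split => [_ [delta _ <-]|_ ->]/=.
  exact: (cover_outer0 (diam_gauge0 delta) (diam_gauge_ge0 delta)).
exists 1; first exact: ltr01.
exact: (cover_outer0 (diam_gauge0 1) (diam_gauge_ge0 1)).
Qed.

Let hausdorff_ge0 (A : set 'cV[R]_d) : (0 <= hausdorff_outer s A)%E.
Proof.
apply: (@le_trans _ _ (cover_outer (diam_gauge s 1) A)).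
  exact: (cover_outer_ge0 (diam_gauge_ge0 1)).
by apply: ereal_sup_ubound; exists 1 => //=; exact: ltr01.
Qed.

Let le_hausdorff :
  {homo @hausdorff_outer R d s : A B / A `<=` B >-> (A <= B)%E}.
Proof.
move=> A B AB; apply: ge_ereal_sup => _ [delta delta0 <-].
apply: (@le_trans _ _ (cover_outer (diam_gauge s delta) B)).
  exact: le_cover_outer.
by apply: ereal_sup_ubound; exists delta.
Qed.

Let hausdorff_sigma_subadditive : sigma_subadditive (@hausdorff_outer R d s).
Proof.
move=> F; apply: ge_ereal_sup => _ [delta delta0 <-].
apply: (@le_trans _ _ (\sum_(i <oo) cover_outer (diam_gauge s delta) (F i))%E).
  exact: (cover_outer_sigma_subadditive (diam_gauge_ge0 delta)).
apply: lee_nneseries => [i _ _|i _]; first exact: (cover_outer_ge0 (diam_gauge_ge0 _)).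
by apply: ereal_sup_ubound; exists delta.
Qed.

HB.instance Definition _ := isOuterMeasure.Build R 'cV[R]_d
  (@hausdorff_outer R d s) hausdorff0 hausdorff_ge0 le_hausdorff
  hausdorff_sigma_subadditive.

End OuterMeasures.

Definition bounded_domain (R : realType) (d : nat) (Om : set 'cV[R]_d) : Prop :=
  [/\ Om !=set0, open Om, connected Om & bounded_set Om].

Definition bdry (R : realType) (d : nat) (Om : set 'cV[R]_d) : set 'cV[R]_d :=
  closure Om `\` interior Om.

(* Near each boundary point, in suitable orthonormal coordinates, Om is the
   strict epigraph of a Lipschitz function of the coordinates other than j. *)
Definition lipschitz_boundary (R : realType) (d : nat) (Om : set 'cV[R]_d) :
    Prop :=
  forall p, bdry Om p ->
    exists (Q : 'M[R]_d) (j : 'I_d) (gamma : 'cV[R]_d.-1 -> R^o),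
      [/\ Q *m Q^T = 1%:M, lipschitz gamma &
        \forall x \near p,
          Om x <-> gamma (row' j (Q *m x)) < (Q *m x) j 0].

Record banach_fun_space (R : realType) (d m : nat) (D : set 'cV[R]_d) :=
  BanachFunSpace {
    carrier :> completeNormedModType R ;
    feval : carrier -> 'cV[R]_d -> 'cV[R]_m ;
    feval_linear : forall (a : R) (u v : carrier) x, D x ->
      feval (a *: u + v) x = a *: feval u x + feval v x ;
    feval_inj : forall u v : carrier,
      (forall x, D x -> feval u x = feval v x) -> u = v
  }.

(* Continuous (injective) embedding into L^nu(D', R^m), where D' carries the
   measure induced by mu. *)
Definition Lnu_embedded (R : realType) (d m : nat) (D : set 'cV[R]_d)
    (U : banach_fun_space m D) (nu : R)
    (mu : {outer_measure set 'cV[R]_d -> \bar R}) (D' : set 'cV[R]_d) : Prop :=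
  let muD' := induced_outer mu D' in
  let LN (u : U) : \bar R :=
    Lnorm (muD' : set (caratheodory_type muD') -> \bar R) nu%:E
      (fun x => (lnorm nu (feval u x))%:E) in
  [/\ forall (u : U) (i : 'I_m),
        measurable_fun [set: caratheodory_type muD'] (fun x => feval u x i 0),
      exists C : R, forall u : U, (LN u <= (C * `|u|)%:E)%E &
      forall u : U, LN u = 0%E -> u = 0].

Definition partials (R : realType) (d m : nat) (s : seq 'I_d)
    (f : 'cV[R]_d -> 'cV[R]_m) : 'cV[R]_d -> 'cV[R]_m :=
  foldr (fun i g x => 'D_(delta_mx i 0) g x) f s.

Definition C_open (R : realType) (d m r : nat) (Om : set 'cV[R]_d)
    (f : 'cV[R]_d -> 'cV[R]_m) : Prop :=
  forall s : seq 'I_d, (size s <= r)%N ->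
    (forall x, Om x -> {for x, continuous (partials s f)}) /\
    ((size s < r)%N -> forall x i, Om x ->
      derivable (partials s f) x (delta_mx i 0)).

(* C^r of the closure: f is continuous on the closure, and all its partial
   derivatives of order <= r on Om extend continuously to the closure. *)
Definition C_closure (R : realType) (d m r : nat) (Om : set 'cV[R]_d)
    (f : 'cV[R]_d -> 'cV[R]_m) : Prop :=
  [/\ C_open r Om f,
      {within closure Om, continuous f} &
      forall s : seq 'I_d, (size s <= r)%N ->
        exists g : 'cV[R]_d -> 'cV[R]_m,
          {within closure Om, continuous g} /\
          (forall x, Om x -> g x = partials s f x)].

Definition multi_index (d r : nat) : Type :=
  {beta : {ffun 'I_d -> nat} | (\sum_(i < d) beta i <= r)%N}.

Definition Dmulti (R : realType) (d m r : nat) (beta : multi_index d r)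
    (f : 'cV[R]_d -> 'cV[R]_m) : 'cV[R]_d -> 'cV[R]_m :=
  partials (flatten [seq nseq (val beta i) i | i <- enum 'I_d]) f.

Definition interior_jet (R : realType) (d m r : nat)
    (f : 'cV[R]_d -> 'cV[R]_m) (z : 'cV[R]_d) (beta : multi_index d r) :
    'cV[R]_m :=
  Dmulti beta f z.

Definition boundary_jet (R : realType) (d m r : nat) (Om : set 'cV[R]_d)
    (f : 'cV[R]_d -> 'cV[R]_m) (z : 'cV[R]_d) (beta : multi_index d r) :
    'cV[R]_m :=
  lim (Dmulti beta f @ within Om (nbhs z)).

Definition interior_operator (R : realType) (d c k r : nat)
    (Om D : set 'cV[R]_d) (U : banach_fun_space c D)
    (V : banach_fun_space k Om) (calF : U -> V) : Prop :=
  exists F : 'cV[R]_d -> (multi_index d r -> 'cV[R]_c) -> 'cV[R]_k,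
    forall (u : U) z, Om z ->
      feval (calF u) z = F z (interior_jet (feval u) z).

Definition boundary_operator (R : realType) (d c k r : nat)
    (Om Ga D : set 'cV[R]_d) (U : banach_fun_space c D)
    (W : banach_fun_space k Ga) (calB : U -> W) : Prop :=
  exists B : 'cV[R]_d -> (multi_index d r -> 'cV[R]_c) -> 'cV[R]_k,
    forall (u : U) z, Ga z ->
      feval (calB u) z = B z (boundary_jet Om (feval u) z).

Definition ad_pinn (R : realType) (d c cF cB : nat) (nu : R)
    (D DF DB : set 'cV[R]_d) (U : banach_fun_space c D)
    (V : banach_fun_space cF DF) (W : banach_fun_space cB DB)
    (calF : U -> V) (calB : U -> W)
    (Oh Gh Dh : {fset 'cV[R]_d}) (ustar : 'cV[R]_d -> 'cV[R]_c)
    (aF aB aD : R) (wF wB wD : 'cV[R]_d -> R) (u : U) : R :=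
  aF * (\sum_(z <- Oh) wF z * lnorm nu (feval (calF u) z) `^ nu) +
  aB * (\sum_(z <- Gh) wB z * lnorm nu (feval (calB u) z) `^ nu) +
  aD * (\sum_(z <- Dh) wD z * lnorm nu (feval u z - ustar z) `^ nu).

Definition minimizes (T : Type) (R : realType) (J : T -> R) (S : set T)
    (u : T) : Prop :=
  S u /\ forall v, S v -> J u <= J v.

Definition C_line (R : realType) (n : nat) (sigma : R -> R) : Prop :=
  (forall k, (k <= n)%N -> continuous (derive1n k sigma)) /\
  (forall k x, (k < n)%N -> derivable (derive1n k sigma) x 1).

Definition network (R : realType) (d c m : nat) (sigma : R -> R)
    (W1 : 'M[R]_(m, d)) (b1 : 'cV[R]_m) (W2 : 'M[R]_(c, m)) (b2 : 'cV[R]_c)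
    (x : 'cV[R]_d) : 'cV[R]_c :=
  W2 *m map_mx sigma (W1 *m x + b1) + b2.

Definition networks_width (R : realType) (d c : nat) (sigma : R -> R)
    (m : nat) : set ('cV[R]_d -> 'cV[R]_c) :=
  [set f | exists W1 b1 W2 b2, f = @network R d c m sigma W1 b1 W2 b2].

Definition networks (R : realType) (d c : nat) (sigma : R -> R) :
    set ('cV[R]_d -> 'cV[R]_c) :=
  \bigcup_(m in [set m | (0 < m)%N]) networks_width sigma m.

Definition restrictions_in (R : realType) (d m : nat) (D : set 'cV[R]_d)
    (U : banach_fun_space m D) (S : set ('cV[R]_d -> 'cV[R]_m)) : Prop :=
  forall f, S f -> exists u : U, forall x, D x -> feval u x = f x.

Definition as_subset (R : realType) (d m : nat) (D : set 'cV[R]_d)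
    (U : banach_fun_space m D) (S : set ('cV[R]_d -> 'cV[R]_m)) : set U :=
  [set u | exists2 f, S f & forall x, D x -> feval u x = f x].

Arguments as_subset {R d m D} U S _.

(* Main.v *)
Require Import Defs.
From mathcomp Require Import all_boot all_order all_algebra finmap.
From mathcomp Require Import all_classical all_reals all_analysis.
From mathcomp Require Import ring zify.
Import Order.TTheory GRing.Theory Num.Theory numFieldNormedType.Exports.

(** The functional is a nonnegative combination of the residuals at finitely
many points, and these residuals depend on u only through its derivatives of
order at most [rF] at the interior points and [rB] at the boundary points.  A
network with the same finite jets as the exact solution therefore has value 0,
which is the minimum.  So everything rests on Hermite interpolation by networks
with one hidden layer ([ridge_jet_interpolation]).

A hidden unit x |-> sigma (w x + a) with weight row w has the jet entries
w^b sigma^(|b|) (w z + a) at z, and prescribed jets can be matched as soon as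
these entries, seen as functions of w, are linearly independent
([ridge_jets_free]): then as many values of w as there are entries give an
invertible linear system ([exists_full_rank_samples]).  The bias a of all units
is the point where no derivative of sigma vanishes.

For the independence, suppose that a combination of the entries vanishes for
all w, and restrict it to the lines w = t v.  If v separates the points z_i,
with s_i = v z_i, this reads
  sum_(i, j) c_ij t^j sigma^(j) (a + t s_i) = 0,
where c_ij is the degree j part, at v, of a polynomial formed from the
coefficients belonging to z_i.  By Taylor's formula ([peano]) the coefficient
of t^k on the left is sigma^(k) (a) / k! times L(X^k), where L is the
functional sum_(i, j) c_ij p^(j) (s_i) on univariate polynomials p.  Hence L
vanishes up to the degree n of smoothness of sigma, and univariate Hermite
interpolation gives c_ij = 0, provided that n + 1 is at least the number of
conditions, the sum of the r_i + 1 ([hermite_unisolvent], [ridge1_free]).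
Finally v runs through the curve (tau, tau^M, tau^(M^2), ...), all but
finitely many of whose points separate the z_i; on it distinct multi-indices
give distinct powers of tau, so all coefficients vanish.

The jet at z has binomial(r_z + d, d) entries, and by superadditivity of
binomial coefficients the sum over all points is at most binomial(ell, d)
([leq_sum_bin]).  The hidden units can be shared by the components of the
output. *)

Set Implicit Arguments.
Unset Strict Implicit.
Unset Printing Implicit Defensive.

Local Open Scope classical_set_scope.
Local Open Scope ring_scope.

(** * Univariate Hermite interpolation *)

(** Each derivative lowers the order of vanishing at s by at most one.  The value
of the cofactor at s is what survives once j reaches m. *)
Lemma derivn_mul_XsubC_exp (R : comNzRingType) (p : {poly R}) (s : R)
    (m j : nat) : (j <= m)%N ->
  exists q : {poly R},
    (p * ('X - s%:P) ^+ m)^`(j) = q * ('X - s%:P) ^+ (m - j) /\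
    q.[s] = (m ^_ j)%:R * p.[s].
Proof.
elim: j => [_|j IH jm]; first by exists p; rewrite subn0 ffactn0 mul1r.
have [q [qE qs]] := IH (ltnW jm).
exists (q^`() * ('X - s%:P) + q *+ (m - j)); split.
  rewrite derivnS qE subnS; have : (0 < m - j)%N by rewrite subn_gt0.
  case: (m - j)%N => // k _ /=.
  by rewrite derivM deriv_exp derivXsubC mul1r mulrnAr mulrDl mulrnAl -mulrA -exprS.
rewrite ffactnSr natrM !hornerE subrr mulr0 add0r hornerMn qs.
by rewrite -mulr_natr mulrAC.
Qed.

(** Uniqueness in univariate Hermite interpolation, in dual form.  A polynomial
that vanishes to full order at every node but [s i0], and to order j at
[s i0], is seen only by the coefficients [c i0 k] with k >= j; descending
induction on j then kills these one at a time. *)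
Lemma hermite_unisolvent (R : numFieldType) (I : finType) (s : I -> R)
    (rho : I -> nat) (c : I -> nat -> R) (n : nat) :
  injective s -> (\sum_i (rho i).+1 <= n)%N ->
  (forall p : {poly R}, (size p <= n)%N ->
    \sum_i \sum_(j < (rho i).+1) c i j * p^`(j).[s i] = 0) ->
  forall i j, (j <= rho i)%N -> c i j = 0.
Proof.
move=> s_inj le_n c0 i0.
(* The induction variable m bounds the number of values from j to rho i0. *)
suff H m : forall j, (j <= rho i0)%N -> (rho i0 < j + m)%N -> c i0 j = 0.
  by move=> j jr; apply: (H (rho i0).+1) => //; rewrite addnS ltnS leq_addl.
elim: m => [|m IH] j jr; first by rewrite addn0 ltnNge jr.
rewrite addnS ltnS => jm.
pose q := \prod_(i | i != i0) ('X - (s i)%:P) ^+ (rho i).+1.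
have szp : (size (q * ('X - (s i0)%:P) ^+ j)%R <= n)%N.
  apply: leq_trans (size_polyMleq _ _) _; rewrite size_exp_XsubC addnS /=.
  apply: leq_trans le_n; rewrite (bigD1 i0) //= addSn -addnS addnC leq_add //.
  apply: leq_trans (size_poly_prod_leq _ _) _.
  under eq_bigr do rewrite size_exp_XsubC -addn1.
  by rewrite big_split /= sum1_card -addSn addnK.
have := c0 _ szp; rewrite (bigD1 i0) //= [X in _ + X]big1 ?addr0; last first.
  move=> i ii0; apply: big1 => k _.
  rewrite /q (bigD1 i) //= -mulrA mulrC.
  set u := (X in _ ^+ _.+1 * X); rewrite [_ ^+ _ * u]mulrC.
  have [v [-> _]] := derivn_mul_XsubC_exp u (s i) (ltnW (ltn_ord k)).
  by rewrite subSn ?leq_ord // !hornerE subrr expr0n !(mul0r, mulr0).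
have jr' : (j < (rho i0).+1)%N by [].
rewrite (bigD1 (Ordinal jr')) //= [X in _ + X]big1 ?addr0; last first.
  move=> k kj; have [kltj|] := ltnP k j.
    have [v [-> _]] := derivn_mul_XsubC_exp q (s i0) (ltnW kltj).
    rewrite !hornerE subrr expr0n subn_eq0 leqNgt kltj.
    by rewrite /= !mulr0.
  rewrite leq_eqVlt => /orP[/eqP jk|jk].
    by move: kj; rewrite -val_eqE /= -jk eqxx.
  rewrite IH ?mul0r ?leq_ord //.
  by rewrite (leq_ltn_trans jm) // ltn_add2r.
have [v [-> vE]] := derivn_mul_XsubC_exp q (s i0) (leqnn j).
rewrite subnn expr0 mulr1 vE ffactnn => /eqP.
rewrite !mulf_eq0 pnatr_eq0 eqn0Ngt fact_gt0 /= => /orP[/eqP //|].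
rewrite /q horner_prod prodf_seq_eq0 => /hasP[i _ /andP[ii0]].
by rewrite !hornerE expf_eq0 subr_eq0 /= (inj_eq s_inj) eq_sym (negPf ii0).
Qed.

(** * Taylor expansion with Peano remainder *)

(** f t = o(t^m) at 0.  The point 0 is left out so that the relation is stable
under division by t. *)
Definition negligible_power (R : realType) (m : nat) (f : R -> R) : Prop :=
  forall e, 0 < e -> \forall t \near (0 : R)^', `|f t| <= e * `|t| ^+ m.

Lemma negligible_powerD (R : realType) (m : nat) (f g : R -> R) :
  negligible_power m f -> negligible_power m g ->
  negligible_power m (fun t => f t + g t).
Proof.
move=> sf sg e e0; have e20 : 0 < e / 2 by rewrite divr_gt0.
near=> t; apply: le_trans (ler_normD _ _) _.
rewrite [e in _ <= e * _]splitr mulrDl lerD //.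
  by near: t; exact: sf.
by near: t; exact: sg.
Unshelve. all: end_near. Qed.

Lemma negligible_power_sum (R : realType) (m : nat) (I : Type) (r : seq I)
    (P : pred I) (f : I -> R -> R) :
  (forall i, P i -> negligible_power m (f i)) ->
  negligible_power m (fun t => \sum_(i <- r | P i) f i t).
Proof.
move=> sf; elim: r => [|i r IH].
  move=> e e0; near=> t; rewrite big_nil normr0 mulr_ge0 ?exprn_ge0 //.
  exact: ltW.
case Pi: (P i); under eq_fun do rewrite big_cons Pi; last exact: IH.
by apply: negligible_powerD => //; exact: sf.
Unshelve. all: end_near. Qed.

Lemma negligible_power_monomialM (R : realType) (m j : nat) (c : R) (f : R -> R) :
  (j <= m)%N -> negligible_power (m - j) f ->
  negligible_power m (fun t => c * t ^+ j * f t).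
Proof.
move=> jm sf e e0; have c1 : 0 < `|c| + 1 by rewrite ltr_wpDl.
near=> t.
have ft : `|f t| <= e / (`|c| + 1) * `|t| ^+ (m - j).
  by near: t; apply: sf; rewrite divr_gt0.
have cft : `|c| * `|f t| <= e * `|t| ^+ (m - j).
  apply: le_trans (ler_wpM2l (normr_ge0 c) ft) _.
  rewrite mulrA ler_wpM2r ?exprn_ge0 // mulrCA ler_piMr ?(ltW e0) //.
  by rewrite ler_pdivrMr // mul1r lerDl.
rewrite !normrM normrX mulrAC -[m in leRHS](subnK jm) exprD mulrA.
by rewrite ler_wpM2r ?exprn_ge0.
Unshelve. all: end_near. Qed.

Lemma negligible_poly_root0 (R : realType) (m : nat) (q : {poly R}) :
  negligible_power m (horner q) -> root q 0.
Proof.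
move=> sq; rewrite rootE -normr_le0; apply/ler_addgt0Pl => e e0; rewrite addr0.
have e20 : 0 < e / 2 by rewrite divr_gt0.
have qc : horner q t @[t --> (0 : R)^'] --> q.[0].
  by apply: cvg_within_filter; exact: continuous_horner.
near ((0 : R)^') => t.
have t1 : `|t| <= 1.
  near: t; apply: nbhs_dnbhs; apply/nbhs_ballP; exists 1 => //= t.
  by rewrite -ball_normE /= sub0r normrN => /ltW.
have qt : `|q.[t]| <= e / 2.
  apply: (@le_trans _ _ (e / 2 * `|t| ^+ m)); first by near: t; exact: sq.
  by rewrite ler_piMr ?(ltW e20) // exprn_ile1.
have q0t : `|q.[0] - q.[t]| <= e / 2.
  by near: t; move/cvgrPdist_le : qc; exact.
rewrite -(subrK q.[t] q.[0]) [leRHS]splitr.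
exact: le_trans (ler_normD _ _) (lerD q0t qt).
Unshelve. all: end_near. Qed.

(** Such a q vanishes at 0, and q / X satisfies the same hypotheses with m one
smaller. *)
Lemma negligible_poly_eq0 (R : realType) (m : nat) (q : {poly R}) :
  (size q <= m.+1)%N -> negligible_power m (horner q) -> q = 0.
Proof.
elim: m q => [|m IH] q szq sq; have q0 := negligible_poly_root0 sq.
  by move: q0; rewrite (size1_polyC szq) rootC => /eqP ->.
have /factor_theorem[q1 qE] := q0; rewrite subr0 in qE.
have [-> //|qN0] := eqVneq q 0.
suff q10 : q1 = 0 by rewrite qE q10 mul0r.
have q1N0 : q1 != 0 by apply: contraNneq qN0 => q10; rewrite qE q10 mul0r.
apply: IH; first by move: szq; rewrite qE size_mulX.
move=> e e0; near=> t.
have t0 : 0 < `|t| by rewrite normr_gt0; near: t; exact: nbhs_dnbhs_neq.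
rewrite -(ler_pM2r t0) -mulrA -exprSr -normrM.
have <- : q.[t] = q1.[t] * t by rewrite qE hornerMX.
by near: t; exact: sq.
Unshelve. all: end_near. Qed.

Lemma MVT_origin (R : realType) (F dF : R -> R) (t : R) :
  (forall x : R, is_derive x 1 F (dF x)) -> t != 0 ->
  exists2 x, 0 < `|x| < `|t| & F t - F 0 = dF x * t.
Proof.
move=> FD t0.
have Fc x : {for x, continuous F}.
  by apply/differentiable_continuous/derivable1_diffP; exact: ex_derive.
have Fw (A : set R) : {within A, continuous F}.
  exact: continuous_subspaceT.
have [tlt|tgt|] := ltgtP t 0; last by move=> /eqP; rewrite (negPf t0).
  have [x xI xE] := MVT tlt (fun x _ => FD x) (Fw _).
  move: xI; rewrite in_itv /= => /andP[tx x0].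
  exists x; first by rewrite !ltr0_norm // oppr_gt0 x0 ltrN2.
  by rewrite -opprB xE -mulrN sub0r opprK.
have [x xI xE] := MVT tgt (fun x _ => FD x) (Fw _).
move: xI; rewrite in_itv /= => /andP[x0 xt].
exists x; first by rewrite !gtr0_norm // x0.
by rewrite xE subr0.
Qed.

(** Taylor's formula with Peano remainder for t |-> sigma^(j) (a + t s).  The
induction is on the number m of derivatives left: the derivative of the
remainder at order j is s times the remainder at order j.+1, and the mean value
theorem integrates the bound. *)
Lemma peano (R : realType) (n : nat) (sigma : R -> R) (a s : R) :
  C_line n sigma -> forall m j, (j + m)%N = n ->
  negligible_power m (fun t => derive1n j sigma (a + t * s) -
     (\poly_(l < m.+1) (derive1n (j + l) sigma a * s ^+ l / (l`!)%:R)).[t]).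
Proof.
move=> [sC sD].
have affc (x : R) : {for x, continuous (fun t : R => a + t * s)}.
  apply: cvgD; first exact: cvg_cst.
  by apply: cvgM; [exact: cvg_id|exact: cvg_cst].
elim=> [|m IH] j jmn e e0.
  apply: nbhs_dnbhs; near=> t; rewrite expr0 mulr1.
  rewrite horner_poly big_ord1 addn0 expr0 fact0 !mulr1 divr1.
  near: t.
  have : {for (0 : R), continuous (fun t : R => derive1n j sigma (a + t * s))}.
    apply: (@continuous_comp R R R (fun t => a + t * s)); first exact: affc.
    by apply: sC; rewrite -jmn leq_addr.
  rewrite /prop_for /continuous_at mul0r addr0 => /cvgrPdist_le /(_ e e0).
  by apply: filterS => t; rewrite distrC.
set p := \poly_(_ < _) _.
have jlt : (j < n)%N by rewrite -jmn addnS ltnS leq_addr.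
pose p1 := \poly_(l < m.+1) (derive1n (j.+1 + l) sigma a * s ^+ l / (l`!)%:R).
have pE : p^`() = s *: p1.
  apply/polyP => l; rewrite coef_deriv coefZ !coef_poly ltnS.
  case: ifP => _; last by rewrite mul0rn mulr0.
  have l1 : l.+1%:R != 0 :> R by rewrite pnatr_eq0.
  have l2 : l`!%:R != 0 :> R by rewrite pnatr_eq0 -lt0n fact_gt0.
  rewrite -mulr_natr factS natrM addnS addSn exprS.
  by field; rewrite l2 nat1r l1.
have FD (x : R) : is_derive x 1 (fun t => derive1n j sigma (a + t * s) - p.[t])
   (s * (derive1n j.+1 sigma (a + x * s) - p1.[x])).
  have sDx : is_derive (a + x * s) 1 (derive1n j sigma) (derive1n j.+1 sigma (a + x * s)).
    by rewrite derive1nS derive1E; apply: DeriveDef => //; exact: sD.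
  have aD : is_derive x 1 (fun t : R => a + t * s) s.
    by apply: is_derive_eq; rewrite scaler0 !add0r mul1r scaler1.
  have /= h := @is_derive1_comp _ (derive1n j sigma) (fun t => a + t * s) x _ _ sDx aD.
  rewrite mulrBr -hornerZ -pE mulrC.
  by apply: is_deriveB.
(* The summand 1 only guards against s = 0. *)
have e'0 : 0 < e / (`|s| + 1) by rewrite divr_gt0 // ltr_wpDl.
have := IH j.+1; rewrite addSnnS => /(_ jmn _ e'0) /nbhs_ballP[d /= d0 dP].
have F0 : derive1n j sigma (a + 0 * s) - p.[0] = 0.
  by rewrite mul0r addr0 horner_coef0 coef_poly /= addn0 expr0 fact0 mulr1 divr1 subrr.
apply/nbhs_ballP; exists d => //= t td t0.
have [x /andP[x0 xt]] := MVT_origin FD t0.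
rewrite F0 subr0 => ->.
have /dP : ball 0 d x.
  by move: td; rewrite -!ball_normE /= !sub0r !normrN; exact: lt_trans.
rewrite -normr_gt0 => /(_ x0) /= le_x.
rewrite !normrM exprS [in leRHS]mulrA [leRHS]mulrAC ler_wpM2r //.
apply: le_trans (ler_wpM2l (normr_ge0 s) le_x) _.
apply: le_trans (_ : _ <= `|s| * (e / (`|s| + 1) * `|t| ^+ m)) _.
  rewrite ler_wpM2l // ler_wpM2l ?(ltW e'0) // lerXn2r ?nnegrE //.
  exact: ltW.
rewrite mulrA ler_wpM2r ?exprn_ge0 // mulrCA ler_piMr ?(ltW e0) //.
by rewrite ler_pdivrMr ?ltr_wpDl // mul1r lerDl.
Unshelve. all: end_near. Qed.

(** * Linear independence of the jets of ridge functions *)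

Lemma poly_eq0_horner (R : numDomainType) (p : {poly R}) :
  (forall x, p.[x] = 0) -> p = 0.
Proof.
move=> p0; apply/eqP; apply: contraT => pN0.
have /(_ [seq k%:R | k <- iota 0 (size p)]) := max_poly_roots pN0.
rewrite size_map size_iota ltnn => -> //.
  by apply/allP => x _; rewrite rootE p0.
by rewrite map_inj_uniq ?iota_uniq // => i j /eqP; rewrite eqr_nat => /eqP.
Qed.

(** The exponent of tau in the monomial w^b when w k = tau ^ (M ^ k). *)
Definition kronecker_exp (d M : nat) (b : 'I_d -> nat) : nat :=
  \sum_k b k * M ^ k.

Lemma kronecker_exp_inj (d M : nat) (b b' : 'I_d -> nat) :
  (forall k, b k < M)%N -> (forall k, b' k < M)%N ->
  kronecker_exp M b = kronecker_exp M b' -> forall k, b k = b' k.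
Proof.
elim: d b b' => [|d IH] b b' bM b'M; first by move=> _ [].
have M0 : (0 < M)%N by apply: leq_ltn_trans (bM ord0).
have kE (f : 'I_d.+1 -> nat) :
    kronecker_exp M f = (f ord0 + kronecker_exp M (f \o lift ord0) * M)%N.
  rewrite /kronecker_exp big_ord_recl muln1 big_distrl /=; congr (_ + _)%N.
  by apply: eq_bigr => k _; rewrite expnSr mulnA.
rewrite !kE => E.
have E0 : b ord0 = b' ord0.
  have := congr1 (modn^~ M) E; rewrite /=.
  by rewrite ![(_ ord0 + _)%N]addnC !modnMDl !modn_small.
have ES : kronecker_exp M (b \o lift ord0) = kronecker_exp M (b' \o lift ord0).
  by move/eqP: E; rewrite E0 eqn_add2l eqn_pmul2r // => /eqP.
move=> k; have [j ->|->//] := unliftP ord0 k.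
exact: (IH (b \o lift ord0) (b' \o lift ord0) (fun=> bM _) (fun=> b'M _) ES).
Qed.

(** Replacing each sigma^(j) by its Taylor polynomial changes the sum by o(t^n),
so the resulting polynomial q is zero.  Its coefficient at t^k is
sigma^(k) (a) / k! times the value at X^k of the functional
p |-> sum_(i, j) c_ij p^(j) (s_i), to which [hermite_unisolvent] applies. *)
Lemma ridge1_free (R : realType) (n : nat) (sigma : R -> R) (a : R)
    (I : finType) (s : I -> R) (rho : I -> nat) (c : I -> nat -> R) :
  C_line n sigma -> (forall k, (k <= n)%N -> derive1n k sigma a != 0) ->
  injective s -> (\sum_i (rho i).+1 <= n.+1)%N ->
  (forall t, \sum_i \sum_(j < (rho i).+1)
     c i j * t ^+ j * derive1n j sigma (a + t * s i) = 0) ->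
  forall i j, (j <= rho i)%N -> c i j = 0.
Proof.
move=> sC sN0 s_inj le_n g0.
have rho_n i : (rho i <= n)%N.
  by rewrite -ltnS (leq_trans _ le_n) // (bigD1 i) //= leq_addr.
pose T i j : {poly R} :=
  \poly_(l < (n - j).+1) (derive1n (j + l) sigma a * s i ^+ l / (l`!)%:R).
pose q := \sum_i \sum_(j < (rho i).+1) c i j *: ('X^j * T i j).
have szq : (size q <= n.+1)%N.
  apply: leq_trans (size_sum _ _ _) _; apply/bigmax_leqP => i _.
  apply: leq_trans (size_sum _ _ _) _; apply/bigmax_leqP => j _.
  rewrite (leq_trans (size_scale_leq _ _)) //.
  rewrite (leq_trans (size_polyMleq _ _)) // size_polyXn addSn /=.
  have jn : (j <= n)%N by rewrite (leq_trans (leq_ord j)).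
  rewrite (leq_trans (leq_add (leqnn j) (size_poly _ _))) //.
  by rewrite addnS subnKC.
have q0 : q = 0.
  apply: (negligible_poly_eq0 szq).
  rewrite (_ : horner q = fun t => \sum_i \sum_(j < (rho i).+1)
      (- c i j) * t ^+ j * (derive1n j sigma (a + t * s i) - (T i j).[t])).
    apply: negligible_power_sum => i _; apply: negligible_power_sum => j _.
    have jn : (j <= n)%N by rewrite (leq_trans (leq_ord j)).
    by apply: negligible_power_monomialM => //; apply: (peano a (s i) sC); rewrite subnKC.
  apply/funext => t; rewrite -[LHS]subr0 -[X in _ - X](g0 t) /q horner_sum -sumrB.
  apply: eq_bigr => i _; rewrite horner_sum -sumrB; apply: eq_bigr => j _.
  by rewrite hornerZ hornerM hornerXn; ring.
apply: (hermite_unisolvent s_inj le_n) => p szp.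
have mono k : (k <= n)%N ->
    \sum_i \sum_(j < (rho i).+1) c i j * ('X^k : {poly R})^`(j).[s i] = 0.
  move=> kn; have skN0 := sN0 k kn.
  have kf : k`!%:R != 0 :> R by rewrite pnatr_eq0 -lt0n fact_gt0.
  have := congr1 (fun p : {poly R} => p`_k * k`!%:R / derive1n k sigma a) q0.
  rewrite coef0 !mul0r => qk; rewrite -[RHS]qk coef_sum !mulr_suml.
  apply: eq_bigr => i _; rewrite coef_sum !mulr_suml; apply: eq_bigr => j _.
  rewrite coefZ coefXnM derivnXn.
  have [kj|jk] := ltnP k j.
    by rewrite ffact_small // mulr0n horner0 !(mulr0, mul0r).
  rewrite coef_poly ltnS leq_sub2r // subnKC // hornerMn hornerXn.
  have kjf : (k - j)`!%:R != 0 :> R by rewrite pnatr_eq0 -lt0n fact_gt0.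
  rewrite -(ffact_fact jk) natrM -mulr_natr.
  by field; rewrite kjf skN0.
have -> : p = \sum_(k < size p) p`_k *: 'X^k.
  by rewrite -[LHS]coefK poly_def.
transitivity (\sum_(k < size p) p`_k *
    \sum_i \sum_(j < (rho i).+1) c i j * ('X^k : {poly R})^`(j).[s i]).
  under [RHS]eq_bigr do rewrite mulr_sumr; rewrite [RHS]exchange_big /=.
  apply: eq_bigr => i _; under [RHS]eq_bigr do rewrite mulr_sumr.
  rewrite [RHS]exchange_big /=; apply: eq_bigr => j _.
  rewrite linear_sum horner_sum mulr_sumr; apply: eq_bigr => k _.
  by rewrite linearZ hornerZ mulrCA.
by apply: big1 => k _; rewrite mono ?mulr0 // -ltnS (leq_trans (ltn_ord k)).
Qed.

(** The factor w^b that the derivative D^b brings out of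
x |-> sigma (w x + a). *)
Definition ridge_monomial (R : realType) (d : nat) (w : 'rV[R]_d)
    (b : 'I_d -> nat) : R := \prod_k w 0 k ^+ b k.

(** Along w = t v with v = (tau, tau^M, tau^(M^2), ...), the relation becomes the
one of [ridge1_free], unless tau is a root of the polynomial DD that detects
two points with equal scalar product with v.  Thus the polynomial q in tau
whose coefficients are the lam i0 b with |b| = j0 vanishes off the roots of DD,
so it is zero; its exponents are pairwise distinct because the digits b k are
smaller than M. *)
Lemma ridge_jets_free (R : realType) (d n M : nat) (sigma : R -> R) (a : R)
    (I : finType) (z : I -> 'cV[R]_d) (rho : I -> nat)
    (lam : I -> {ffun 'I_d -> 'I_M} -> R) :
  C_line n sigma -> (forall k, (k <= n)%N -> derive1n k sigma a != 0) ->
  injective z -> (\sum_i (rho i).+1 <= n.+1)%N -> (1 < M)%N ->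
  (forall w : 'rV[R]_d,
     \sum_i \sum_(b : {ffun 'I_d -> 'I_M} | (\sum_k b k <= rho i)%N)
       lam i b * (ridge_monomial w (fun k => b k) *
         derive1n (\sum_k b k) sigma ((w *m z i) 0 0 + a)) = 0) ->
  forall i (b : {ffun 'I_d -> 'I_M}), (\sum_k b k <= rho i)%N -> lam i b = 0.
Proof.
move=> sC sN0 z_inj le_n M1 H i0 b0 b0r.
pose e (b : {ffun 'I_d -> 'I_M}) := kronecker_exp M (fun k => b k : nat).
(* D i i' is the scalar product of v with z i - z i' as a polynomial in tau. *)
pose D i i' : {poly R} := \sum_k (z i k 0 - z i' k 0) *: 'X^(M ^ k).
pose DD := \prod_(p : I * I | p.1 != p.2) D p.1 p.2.
have DN0 : DD != 0.
  apply/prodf_neq0 => -[i i'] /= ii'.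
  have /matrix0Pn[k [u zk]] : z i - z i' != 0 by rewrite subr_eq0 (inj_eq z_inj).
  rewrite ord1 !mxE in zk; apply: contra zk => /eqP/(congr1 (fun p : {poly R} => p`_(M ^ k))).
  rewrite coef0 coef_sum (bigD1 k) //= coefZ coefXn eqxx mulr1 big1 ?addr0 => [-> //|l lk].
  by rewrite coefZ coefXn eqn_exp2l // val_eqE eq_sym (negPf lk) mulr0.
pose j0 := (\sum_k b0 k)%N.
pose q := \sum_(b : {ffun 'I_d -> 'I_M} | (\sum_k b k == j0)%N) lam i0 b *: 'X^(e b) : {poly R}.
have q0 : q = 0.
  suff /eqP : q * DD = 0 by rewrite mulf_eq0 (negPf DN0) orbF => /eqP.
  apply: poly_eq0_horner => tau; rewrite hornerM.
  have [->|Dt] := eqVneq DD.[tau] 0; first by rewrite mulr0.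
  pose v := \row_(k < d) tau ^+ (M ^ k).
  pose s i := (v *m z i) 0 0.
  have s_inj : injective s.
    move=> i i' si; apply/eqP; apply: contraT => ii'.
    move: Dt; rewrite /DD horner_prod => /prodf_neq0 /(_ (i, i') ii') /=.
    rewrite horner_sum; under eq_bigr do rewrite !hornerE mulrBl.
    rewrite sumrB subr_eq0 => /negP[]; apply/eqP; move: si; rewrite /s !mxE => si.
    transitivity (\sum_j v 0 j * z i j 0); first by apply: eq_bigr => k _; rewrite mxE mulrC.
    by rewrite si; apply: eq_bigr => k _; rewrite mxE mulrC.
  pose c i j := \sum_(b : {ffun 'I_d -> 'I_M} | (\sum_k b k == j)%N) lam i b * tau ^+ e b.
  suff c0 : c i0 j0 = 0.
    have -> : q.[tau] = c i0 j0; last by rewrite c0 mul0r.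
    by rewrite horner_sum; apply: eq_bigr => b _; rewrite hornerZ hornerXn.
  apply: (ridge1_free (rho := rho) (s := s) sC sN0) => // t.
  rewrite -[RHS](H (t *: v)); apply: eq_bigr => i _.
  pose deg (b : {ffun 'I_d -> 'I_M}) : 'I_(rho i).+1 := inord (\sum_k b k).
  rewrite [RHS](partition_big deg xpredT) //=.
  apply: eq_bigr => j _; rewrite -mulrA mulr_suml.
  apply: eq_big => [b|b /eqP <-].
    apply/eqP/andP => [bj|[br /eqP <-]]; last by rewrite /deg inordK.
    by rewrite /deg bj leq_ord; split => //; rewrite inord_val.
  rewrite -!mulrA; congr (_ * _); rewrite mulrA; congr (_ * _).
    rewrite /ridge_monomial /e /kronecker_exp -!prodrXr -big_split /=.
    apply: eq_bigr => k _; rewrite !mxE exprMn mulrC; congr (_ * _).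
    by rewrite -exprM mulnC.
  by rewrite -scalemxAl mxE addrC.
have := congr1 (fun p : {poly R} => p`_(e b0)) q0.
rewrite coef0 coef_sum (bigD1 b0) //= coefZ coefXn eqxx mulr1 big1 ?addr0 // => b /andP[_ bb0].
rewrite coefZ coefXn; case: eqP => [E|_]; last by rewrite mulr0.
case/eqP: bb0; apply/ffunP => k; apply: val_inj.
by apply: (kronecker_exp_inj _ _ (esym E)) => l; exact: ltn_ord.
Qed.

(** * Interpolation of jets by one hidden layer *)

(** As long as the sampled rows span a proper subspace, some nonzero functional
lam annihilates them; by independence it does not annihilate all rows, and
adding one on which it is nonzero raises the rank.  The points x are chosen
before the data y: this lets all components of a network share their hidden
units. *)
Lemma exists_full_rank_samples (F : fieldType) (X : Type) (T : finType)
    (phi : X -> T -> F) (x0 : X) :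
  (forall lam : T -> F,
    (forall x, \sum_t lam t * phi x t = 0) -> forall t, lam t = 0) ->
  forall m, (#|T| <= m)%N -> exists x : 'I_m -> X,
    forall y : T -> F, exists b : 'I_m -> F,
      forall t, \sum_j b j * phi (x j) t = y t.
Proof.
move=> phi_free.
pose A k (x : 'I_k -> X) := \matrix_(j < k, i < #|T|) phi (x j) (enum_val i).
have rk k : exists x : 'I_k -> X, (minn k #|T| <= \rank (A k x))%N.
  elim: k => [|k [x rx]]; first by exists (fun=> x0); rewrite min0n.
  pose ext v (i : 'I_(1 + k)) := if fintype.split i is inr j then x j else v.
  have AE v : A _ (ext v) = col_mx (\row_i phi v (enum_val i)) (A k x).
    apply/matrixP => i j; rewrite !mxE /ext; case: fintype.splitP => l _.
      by rewrite ord1 mxE.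
    by rewrite mxE.
  have rkE v : \rank (A _ (ext v)) = \rank (\row_i phi v (enum_val i) + A k x)%MS.
    by rewrite AE addsmxE.
  have [full|rlt] := leqP #|T| (\rank (A k x)).
    exists (ext x0); apply: leq_trans (geq_minr _ _) _.
    by apply: leq_trans full _; rewrite rkE mxrankS ?addsmxSr.
  have : cokermx (A k x) != 0.
    by rewrite -mxrank_eq0 mxrank_coker subn_eq0 -ltnNge.
  move=> /matrix0Pn[i [j cij]].
  have /existsNP[v /eqP vN] :
      ~ forall v, \sum_t cokermx (A k x) (enum_rank t) j * phi v t = 0.
    move=> /(phi_free (fun t => _)) /(_ (enum_val i)) /eqP.
    by rewrite enum_valK (negPf cij).
  have vNA : ~~ (\row_i phi v (enum_val i) <= A k x)%MS.
    apply: contra vN; rewrite submxE => /eqP/rowP/(_ j).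
    rewrite !mxE (reindex _ (onW_bij _ (@enum_val_bij T))) => E.
    apply/eqP; rewrite -[RHS]E; apply: eq_bigr => l _.
    by rewrite enum_valK mulrC [(\row__ _) _ _]mxE.
  exists (ext v); apply: leq_trans (_ : _ <= (\rank (A k x)).+1)%N _.
    by move: rx; rewrite !geq_min ltnS => /orP[->//|]; rewrite leqNgt rlt.
  rewrite rkE ltn_neqAle mxrankS ?addsmxSr // andbT.
  rewrite (mxrank_leqif_sup (addsmxSr _ _)).2.
  by apply: contra vNA => /(submx_trans (addsmxSl _ _)).
move=> m le_m; have [x rx] := rk m; exists x => y.
have full : row_full (A m x).
  by rewrite -col_leq_rank; move: rx; rewrite (minn_idPr le_m).
have /submxP[D yE] := submx_full (\row_i y (enum_val i)) full.
exists (fun j => D 0 j) => t; have /rowP/(_ (enum_rank t)) := yE.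
rewrite !mxE enum_rankK => ->; apply: eq_bigr => j _.
by rewrite mxE enum_rankK.
Qed.

(** For d > 0, the d-element subsets of the two parts of a disjoint union are
distinct d-element subsets of the whole. *)
Lemma leq_add_bin (d a b : nat) : (0 < d)%N ->
  ('C(a, d) + 'C(b, d) <= 'C(a + b, d))%N.
Proof.
case: d => // d _; elim: a => [|a IH]; first by rewrite bin0n.
by rewrite addSn !binS addnAC leq_add // leq_bin2l // leq_addr.
Qed.

(** With F i = r_i + d this bounds the number of jet entries at all points, and
hence the number of hidden units. *)
Lemma leq_sum_bin (I : Type) (d : nat) (r : seq I) (F : I -> nat) : (0 < d)%N ->
  (\sum_(i <- r) 'C(F i, d) <= 'C(\sum_(i <- r) F i, d))%N.
Proof.
move=> d0; elim: r => [|i r IH]; first by rewrite !big_nil.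
by rewrite !big_cons (leq_trans _ (leq_add_bin _ _ d0)) // leq_add2l.
Qed.

Lemma leq_card_multi_index (d M r : nat) :
  (#|[set b : {ffun 'I_d -> 'I_M} | \sum_k b k <= r]| <= 'C(r + d, d))%N.
Proof.
rewrite addnC -card_partial_ord_partitions.
pose f (b : {ffun 'I_d -> 'I_M}) : d.-tuple 'I_r.+1 := [tuple inord (b k) | k < d].
have br (b : {ffun 'I_d -> 'I_M}) : b \in [set b : {ffun 'I_d -> 'I_M} | \sum_k b k <= r]%N ->
    forall k, (b k < r.+1)%N.
  by rewrite inE => + k; apply: leq_trans; rewrite (bigD1 k) //= leq_addr.
rewrite -(card_in_imset (f := f)) => [|b b' /br bl /br bl' E]; last first.
  apply/ffunP => k; apply: val_inj => /=.
  by have /(congr1 val) := congr1 (fun t => tnth t k) E; rewrite !tnth_mktuple /= !inordK.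
apply/subset_leq_card/fintype.subsetP => _ /imsetP[b bin ->].
rewrite inE big_tuple; move: (bin); rewrite inE; apply: leq_trans.
apply: eq_leq; apply: eq_bigr => k _; rewrite tnth_mktuple inordK //.
exact: br.
Qed.

(** The entries of the jets are the functions of the weight row w that
[ridge_jets_free] shows to be independent; sampling them at m rows gives W, and
the output weights V solve a linear system for each component. *)
Theorem ridge_jet_interpolation (R : realType) (d c m n : nat)
    (sigma : R -> R) (a : R) (zs : seq 'cV[R]_d) (r : 'cV[R]_d -> nat) :
  C_line n sigma -> (forall k, (k <= n)%N -> derive1n k sigma a != 0) ->
  uniq zs -> (\sum_(z <- zs) (r z).+1 <= n.+1)%N ->
  (\sum_(z <- zs) 'C(r z + d, d) <= m)%N ->
  exists W : 'M[R]_(m, d), forall y : 'cV[R]_d -> ('I_d -> nat) -> 'cV[R]_c,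
    exists V : 'M[R]_(c, m), forall z (b : 'I_d -> nat),
      z \in zs -> (\sum_k b k <= r z)%N ->
      V *m (\col_j (ridge_monomial (row j W) b *
        derive1n (\sum_k b k) sigma ((W *m z) j 0 + a))) = y z b.
Proof.
move=> sC sN0 zs_uniq le_n le_m.
pose N := size zs; pose z (i : 'I_N) := nth 0 zs i.
have z_inj : injective z.
  by move=> i j /eqP; rewrite nth_uniq // => /eqP; exact: val_inj.
have sumz (F : 'cV[R]_d -> nat) : (\sum_(z <- zs) F z = \sum_i F (z i))%N.
  by rewrite (big_nth 0) big_mkord.
have rz_n i : (r (z i) <= n)%N.
  by rewrite -ltnS (leq_trans _ le_n) // sumz (bigD1 i) //= leq_addr.
(* Since r z <= n, the entries of the multi-indices needed fit in 'I_n.+2; the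
   successor is there to have a base M > 1 even for n = 0. *)
pose good (p : 'I_N * {ffun 'I_d -> 'I_n.+2}) := (\sum_k p.2 k <= r (z p.1))%N.
pose T := {p | good p}.
pose phi (w : 'rV[R]_d) (t : T) : R := ridge_monomial w (fun k => (val t).2 k) *
  derive1n (\sum_k (val t).2 k) sigma ((w *m z (val t).1) 0 0 + a).
have phi_free (lam : T -> R) :
    (forall w, \sum_t lam t * phi w t = 0) -> forall t, lam t = 0.
  move=> lam0 t.
  pose mu i (b : {ffun 'I_d -> 'I_n.+2}) : R :=
    if insub (i, b) is Some u then lam u else 0.
  have muE (u : T) : mu (val u).1 (val u).2 = lam u.
    by rewrite /mu -surjective_pairing valK.
  rewrite -muE.
  apply: (ridge_jets_free (rho := fun i => r (z i)) sC sN0 z_inj _ _ _ (valP t)) => //.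
    by rewrite -(sumz (fun z => (r z).+1)).
  move=> w; rewrite -[RHS](lam0 w) pair_big_dep /= big_sub /=.
  by apply: eq_bigr => u _; rewrite muE.
have card_T : (#|{: T}| <= m)%N.
  apply: leq_trans le_m; rewrite card_sig -sum1_card.
  rewrite (eq_bigl (fun p => true && good p)) //=.
  rewrite -(pair_big_dep xpredT (fun i b => good (i, b)) (fun _ _ => 1%N)) /=.
  rewrite sumz leq_sum // => i _; rewrite sum1_card.
  apply: leq_trans (leq_card_multi_index _ n.+2 _).
  by apply/subset_leq_card/fintype.subsetP => b; rewrite inE.
have [w wP] := exists_full_rank_samples 0 phi_free card_T.
exists (\matrix_j w j) => y.
have /choice [V VP] : forall i : 'I_c, exists b : 'I_m -> R,
    forall t : T, \sum_j b j * phi (w j) t = y (z (val t).1) (fun k => (val t).2 k) i 0.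
  by move=> i; exact: wP.
exists (\matrix_(i, j) V i j) => x b /(nthP 0)[i0 iN <-] br.
pose i := Ordinal iN; rewrite -[nth _ _ _]/(z i) in br *.
pose b' : {ffun 'I_d -> 'I_n.+2} := [ffun k => inord (b k)].
have b'E k : b' k = b k :> nat.
  rewrite ffunE inordK // ltnS leqW // (leq_trans _ (rz_n i)) // (leq_trans _ br) //.
  by rewrite (bigD1 k) //= leq_addr.
have b'_good : good (i, b') by rewrite /good /=; under eq_bigr do rewrite b'E.
apply/colP => k; have := VP k (exist _ (i, b') b'_good); rewrite /phi /=.
have -> : (fun k => b' k : nat) = b by apply/funext.
move=> <-; rewrite mxE; apply: eq_bigr => j _.
rewrite [(\matrix_(_, _) V _ _) _ _]mxE [(\col__ _) _ _]mxE rowK.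
have -> : (\sum_k b' k = \sum_k b k)%N by apply: eq_bigr.
have -> // : ((\matrix_j w j) *m z i) j 0 = (w j *m z i) 0 0.
by rewrite !mxE; apply: eq_bigr => l _; rewrite mxE.
Qed.

(** * Partial derivatives of networks *)

(** A function of a quantity that is affine along the line x + h v has a
directional derivative given by the chain rule in the single variable h. *)
Lemma is_derive_along_line (R : realType) (d : nat) (g : R -> R)
    (L : 'cV[R]_d -> R) (x v : 'cV[R]_d) (l dg : R) :
  (forall h, L (h *: v + x) = L x + h * l) -> is_derive (L x) 1 g dg ->
  is_derive x v (g \o L) (l * dg).
Proof.
move=> Lline gD.
have lineD : is_derive (0 : R) 1 (fun h : R => L x + h * l) l.
  by apply: is_derive_eq; rewrite scaler0 !add0r mul1r scaler1.
have gD' : is_derive (L x + 0 * l) 1 g dg by rewrite mul0r addr0.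
have [FD FE] := @is_derive1_comp _ g (fun h => L x + h * l) 0 _ _ gD' lineD.
have quotE : (fun h : R => h^-1 *: (((g \o L) \o shift x) (h *: v) - (g \o L) x)) =
    (fun h : R => h^-1 *: (((g \o (fun h => L x + h * l)) \o shift 0) (h *: 1)
       - (g \o (fun h => L x + h * l)) 0)).
  apply/funext => h /=; rewrite Lline mul0r !addr0.
  by rewrite [h *: 1]mulr1.
apply: DeriveDef; first by rewrite /derivable quotE.
by rewrite /derive quotE mulrC.
Qed.

Lemma partials_eq_open (R : realType) (d m : nat) (Om : set 'cV[R]_d)
    (f g : 'cV[R]_d -> 'cV[R]_m) : open Om -> (forall x, Om x -> f x = g x) ->
  forall s x, Om x -> partials s f x = partials s g x.
Proof.
move=> oOm fg; elim=> [|i s IH] x Omx /=; first exact: fg.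
apply: near_eq_derive; near=> y; apply: IH.
by near: y; exact: open_nbhs_nbhs.
Unshelve. all: end_near. Qed.

Lemma partials_network (R : realType) (d c m n : nat) (sigma : R -> R)
    (W1 : 'M[R]_(m, d)) (b1 : 'cV[R]_m) (W2 : 'M[R]_(c, m)) :
  C_line n sigma -> forall s x, (size s <= n)%N ->
  partials s (network sigma W1 b1 W2 0) x =
  W2 *m (\col_j (\prod_(i <- s) W1 j i *
                 derive1n (size s) sigma ((W1 *m x) j 0 + b1 j 0))).
Proof.
move=> [sC sD]; elim=> [|i s IH] x sn.
  rewrite /= /network addr0; congr (_ *m _); apply/colP => j.
  by rewrite [LHS]mxE [RHS]mxE big_nil mul1r; congr sigma; rewrite mxE.
rewrite /= -/(partials s _).
have -> : partials s (network sigma W1 b1 W2 0) = (fun x =>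
  W2 *m (\col_j (\prod_(i <- s) W1 j i *
                 derive1n (size s) sigma ((W1 *m x) j 0 + b1 j 0)))).
  by apply/funext => y; apply: IH; exact: ltnW.
have entryD (k : 'I_c) (o : 'I_1) : is_derive x (delta_mx i 0 : 'cV[R]_d)
    (fun x : 'cV[R]_d => (W2 *m (\col_j (\prod_(i <- s) W1 j i *
       derive1n (size s) sigma ((W1 *m x) j 0 + b1 j 0)))) k o)
    (\sum_j W2 k j * (\prod_(i <- i :: s) W1 j i *
       derive1n (size s).+1 sigma ((W1 *m x) j 0 + b1 j 0))).
  pose h j : 'cV[R]_d -> R := (W2 k j * \prod_(i <- s) W1 j i) *:
    (derive1n (size s) sigma \o (fun x => (W1 *m x) j 0 + b1 j 0)).
  rewrite (_ : (fun _ => _) = \sum_j h j); last first.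
    apply/funext => y; rewrite mxE fct_sumE; apply: eq_bigr => j _.
    by rewrite mxE mulrA.
  have hD j : is_derive x (delta_mx i 0 : 'cV[R]_d) (h j)
     ((W2 k j * \prod_(i <- s) W1 j i) *: (W1 j i *
       derive1n (size s).+1 sigma ((W1 *m x) j 0 + b1 j 0))).
    apply: is_deriveZ; apply: is_derive_along_line.
      move=> l; rewrite mulmxDr -scalemxAr -colE addrAC; congr (_ + _).
      by rewrite mxE addrC; congr (_ + _); rewrite !mxE.
    by rewrite derive1nS derive1E; apply: DeriveDef => //; exact: sD.
  apply: is_derive_eq; apply: eq_bigr => j _.
  by rewrite -[LHS]/(_ * _) big_cons; ring.
rewrite derive_mx; last by apply/derivable_mxP => k o; exact: ex_derive.
apply/matrixP => k o; rewrite mxE derive_val mxE; apply: eq_bigr => j _.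
by congr (_ * _); rewrite [RHS]mxE.
Qed.

Lemma continuous_ridge_sum (R : realType) (d c m : nat) (g : R -> R)
    (W1 : 'M[R]_(m, d)) (b1 : 'cV[R]_m) (W2 : 'M[R]_(c, m)) (p : 'I_m -> R) :
  continuous g ->
  continuous (fun x : 'cV[R]_d =>
    W2 *m (\col_j (p j * g ((W1 *m x) j 0 + b1 j 0)))).
Proof.
move=> gC.
have lC j : continuous (fun x : 'cV[R]_d => (W1 *m x) j 0 + b1 j 0).
  rewrite (_ : (fun _ => _) =
      (fun x : 'cV[R]_d => \sum_k W1 j k * x k 0 + b1 j 0)); last first.
    by apply/funext => y; rewrite mxE.
  have sumC : continuous (fun x : 'cV[R]_d => \sum_k W1 j k * x k 0).
    apply: (continuous_big add_continuous) => k _ x.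
    exact: (cvgM (cvg_cst _) (@coord_continuous _ _ _ k 0 x)).
  by move=> x; exact: (cvgD (sumC x) (cvg_cst _)).
rewrite (_ : (fun _ => _) = (fun x : 'cV[R]_d =>
    \sum_j (p j * g ((W1 *m x) j 0 + b1 j 0)) *: col j W2)); last first.
  apply/funext => y; apply/colP => k; rewrite mxE summxE; apply: eq_bigr => j _.
  by rewrite [(\col__ _) _ _]mxE [RHS]mxE [(col _ _) _ _]mxE mulrC.
apply: (continuous_big add_continuous) => j _ x.
have gLc : {for x, continuous (fun x : 'cV[R]_d => g ((W1 *m x) j 0 + b1 j 0))}.
  exact: (continuous_comp (lC j x) (gC _)).
exact: (cvgZr_tmp (cvgM (cvg_cst (p j)) gLc)).
Qed.

Lemma continuous_partials_network (R : realType) (d c m n : nat) (sigma : R -> R)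
    (W1 : 'M[R]_(m, d)) (b1 : 'cV[R]_m) (W2 : 'M[R]_(c, m)) (s : seq 'I_d) :
  C_line n sigma -> (size s <= n)%N ->
  continuous (partials s (network sigma W1 b1 W2 0)).
Proof.
move=> sC sn.
have /funext -> := fun x => partials_network W1 b1 W2 sC x sn.
by apply: continuous_ridge_sum; exact: sC.1.
Qed.

(** The word along which [Dmulti] differentiates. *)
Definition index_word (d : nat) (b : 'I_d -> nat) : seq 'I_d :=
  flatten [seq nseq (b i) i | i <- enum 'I_d].

Lemma size_index_word (d : nat) (b : 'I_d -> nat) :
  size (index_word b) = (\sum_k b k)%N.
Proof.
rewrite size_flatten /shape -map_comp sumnE big_map big_enum /=.
by apply: eq_bigr => k _; rewrite size_nseq.
Qed.

Lemma prod_index_word (R : realType) (d : nat) (w : 'rV[R]_d) (b : 'I_d -> nat) :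
  \prod_(i <- index_word b) w 0 i = ridge_monomial w b.
Proof.
rewrite big_flatten big_map big_enum /=; apply: eq_bigr => k _.
by rewrite big_nseq iter_mulr_1.
Qed.

(** Boundary jets of a function that is only known on Om: if it agrees there with
a function g continuous at z, its boundary value is g z. *)
Lemma lim_within_eq_open (R : realType) (d m : nat) (Om : set 'cV[R]_d)
    (f g : 'cV[R]_d -> 'cV[R]_m) (z : 'cV[R]_d) :
  closure Om z -> (forall x, Om x -> f x = g x) -> {for z, continuous g} ->
  lim (f @ within Om (nbhs z)) = g z.
Proof.
move=> clz fg gc; have PF := within_nbhs_proper clz.
apply: (cvg_lim (@norm_hausdorff _ _)).
have gw : g @ within Om (nbhs z) --> g z by apply: cvg_within_filter.
apply: cvg_trans gw; apply: near_eq_cvg.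
by apply: filterS (withinT _ _) => x /fg.
Qed.

(** * Exact solutions and minimizers *)

Lemma ad_pinn_ge0 (R : realType) (d c cF cB : nat) (nu : R)
    (D DF DB : set 'cV[R]_d) (U : banach_fun_space c D)
    (V : banach_fun_space cF DF) (W : banach_fun_space cB DB)
    (calF : U -> V) (calB : U -> W) (Oh Gh Dh : {fset 'cV[R]_d})
    (ustar : 'cV[R]_d -> 'cV[R]_c) (aF aB aD : R)
    (wF wB wD : 'cV[R]_d -> R) (u : U) :
  0 <= aF -> 0 <= aB -> 0 <= aD ->
  (forall z, z \in Oh -> 0 <= wF z) -> (forall z, z \in Gh -> 0 <= wB z) ->
  (forall z, z \in Dh -> 0 <= wD z) ->
  0 <= ad_pinn nu calF calB Oh Gh Dh ustar aF aB aD wF wB wD u.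
Proof.
move=> aF0 aB0 aD0 wF0 wB0 wD0.
have sum_ge0 (X : {fset 'cV[R]_d}) (w h : 'cV[R]_d -> R) :
    (forall z, z \in X -> 0 <= w z) -> 0 <= \sum_(z <- X) w z * h z `^ nu.
  move=> w0; rewrite big_seq; apply: sumr_ge0 => z /w0 wz.
  by rewrite mulr_ge0 // powR_ge0.
by rewrite /ad_pinn !addr_ge0 // mulr_ge0 // sum_ge0.
Qed.

Lemma lnorm0_powR (R : realType) (nu : R) (m : nat) :
  nu != 0 -> lnorm nu (0 : 'cV[R]_m) `^ nu = 0.
Proof.
move=> nu0; rewrite /lnorm big1 => [|i _]; last by rewrite mxE normr0 powR0.
by rewrite !powR0 // invr_neq0.
Qed.

Lemma leq_sum_undup (T : eqType) (s : seq T) (G : T -> nat) :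
  (\sum_(z <- undup s) G z <= \sum_(z <- s) G z)%N.
Proof.
elim: s => //= z s IH; rewrite big_cons; case: ifP => _.
  exact: leq_trans IH (leq_addl _ _).
by rewrite big_cons leq_add2l.
Qed.

Theorem theorem3p3 (R : realType) (d c cF cB rF rB : nat) (nu : R)
  (d_gt0 : (0 < d)%N) (c_gt0 : (0 < c)%N)
  (cF_gt0 : (0 < cF)%N) (cB_gt0 : (0 < cB)%N) (nu_ge1 : 1 <= nu)
  (Om Ga : set 'cV[R]_d)
  (Om_dom : bounded_domain Om) (Om_lip : lipschitz_boundary Om)
  (Ga_bdry : Ga `<=` bdry Om)
  (U : banach_fun_space c (closure Om))
  (V : banach_fun_space cF Om) (W : banach_fun_space cB Ga)
  (U_emb : Lnu_embedded U nu (@lebesgue_outer R d) Om)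
  (V_emb : Lnu_embedded V nu (@lebesgue_outer R d) Om)
  (W_emb : Lnu_embedded W nu (@hausdorff_outer R d d.-1) Ga)
  (U_smooth : forall u : U,
     C_open rF Om (feval u) /\ C_closure rB Om (feval u))
  (calF : U -> V) (calB : U -> W)
  (calF_local : interior_operator rF calF)
  (calB_local : boundary_operator rB Om calB)
  (NF NB : nat) (NF_gt0 : (0 < NF)%N) (NB_gt0 : (0 < NB)%N)
  (zF : 'I_NF -> 'cV[R]_d) (zB : 'I_NB -> 'cV[R]_d)
  (zF_in : forall i, Om (zF i)) (zB_in : forall j, Ga (zB j))
  (Dh : {fset 'cV[R]_d}) (ustar : 'cV[R]_d -> 'cV[R]_c)
  (aF aB aD : R) (wF wB wD : 'cV[R]_d -> R) (sigma : R -> R) :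
  let Oh := [fset zF i | i in 'I_NF]%fset in
  let Gh := [fset zB j | j in 'I_NB]%fset in
  let ell := (NF * (d + rF) + NB * (d + rB))%N in
  let J := ad_pinn nu calF calB Oh Gh Dh ustar aF aB aD wF wB wD in
  let H := as_subset U (@networks R d c sigma) in
  let HM := as_subset U (@networks_width R d c sigma (c * 'C(ell, d))) in
  (Dh `<=` Oh `|` Gh)%fset ->
  0 <= aF -> 0 <= aB -> 0 <= aD ->
  (forall z, z \in Oh -> 0 <= wF z) ->
  (forall z, z \in Gh -> 0 <= wB z) ->
  (forall z, z \in Dh -> 0 <= wD z) ->
  C_line (ell - d) sigma ->
  (exists a : R, forall k, (k <= ell - d)%N -> derive1n k sigma a != 0) ->
  restrictions_in U (@networks R d c sigma) ->
  forall uhat : U,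
  (forall z, Om z -> feval (calF uhat) z = 0) ->
  (forall z, Ga z -> feval (calB uhat) z = 0) ->
  aD = 0 ->
  HM `<=` H /\
  exists utheta : U, [/\ HM utheta, minimizes J H utheta & J utheta = 0].
Proof.
move=> Oh Gh ell J H HM _ aF0 aB0 aD0 wF0 wB0 wD0 sC [a sN0] rest uhat Fhat Bhat aDE.
have [_ oOm _ _] := Om_dom.
have Ga_notin z : Ga z -> ~ Om z.
  by move=> /Ga_bdry[_ +] Omz; apply; rewrite (interior_id _).1.
have Ga_cl z : Ga z -> closure Om z by move=> /Ga_bdry[].
have ell_ge : (d + rF + rB <= ell)%N by rewrite /ell; nia.
have m_gt0 : (0 < c * 'C(ell, d))%N.
  by rewrite muln_gt0 c_gt0 bin_gt0; lia.
split.
  by move=> u [f fN uf]; exists f => //; exists (c * 'C(ell, d))%N.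
(* Repeated collocation points must be merged, since interpolation needs distinct
   nodes; no point carries both an interior and a boundary condition. *)
pose zs := undup (codom zF ++ codom zB).
pose r z := if `[< Om z >] then rF else rB.
have rF_in z : Om z -> r z = rF by move=> Omz; rewrite /r asboolT.
have rB_in z : Ga z -> r z = rB by move=> /Ga_notin nOm; rewrite /r asboolF.
have le_undup (G : 'cV[R]_d -> nat) :
    (\sum_(z <- zs) G z <= \sum_i G (zF i) + \sum_j G (zB j))%N.
  by apply: leq_trans (leq_sum_undup _ _) _; rewrite big_cat !big_image.
have zs_ell : (\sum_(z <- zs) (r z + d) <= ell)%N.
  apply: leq_trans (le_undup _) _; rewrite /ell.
  under eq_bigr do rewrite rF_in //.
  under [X in (_ + X)%N]eq_bigr do rewrite rB_in //.
  by rewrite !sum_nat_const !card_ord [(d + rF)%N]addnC [(d + rB)%N]addnC.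
have zs_gt0 : (0 < size zs)%N.
  have : zF (Ordinal NF_gt0) \in zs by rewrite mem_undup mem_cat codom_f.
  by case: (zs).
(* There is at least one point, so replacing d by 1 in every summand of ell saves
   at least d - 1. *)
have zs_n : (\sum_(z <- zs) (r z).+1 <= (ell - d).+1)%N.
  have : (\sum_(z <- zs) ((r z).+1 + d.-1) <= ell)%N.
    by apply: leq_trans zs_ell; apply: eq_leq; apply: eq_bigr => z _; lia.
  rewrite big_split /= big_const_seq count_predT iter_addn_0.
  move: (leq_pmulr d.-1 zs_gt0) ell_ge d_gt0.
  move: (\sum_(z <- zs) _)%N (d.-1 * size zs)%N (ell) => S D e; lia.
have zs_m : (\sum_(z <- zs) 'C(r z + d, d) <= c * 'C(ell, d))%N.
  apply: leq_trans (leq_sum_bin _ _ d_gt0) _.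
  by apply: leq_trans (leq_bin2l _ zs_ell) _; rewrite leq_pmull.
have [W1 W1P] := ridge_jet_interpolation c sC sN0 (undup_uniq _) zs_n zs_m.
(* The jets of the exact solution: derivatives inside Om, their boundary values
   on the boundary. *)
pose y z (b : 'I_d -> nat) : 'cV[R]_c :=
  if `[< Om z >] then partials (index_word b) (feval uhat) z
  else lim (partials (index_word b) (feval uhat) @ within Om (nbhs z)).
have [W2 W2P] := W1P y.
pose net : 'cV[R]_d -> 'cV[R]_c := network sigma W1 (const_mx a) W2 0.
have netN : networks_width sigma (c * 'C(ell, d)) net.
  by exists W1, (const_mx a), W2, 0.
have [|u uE] := rest net; first by exists (c * 'C(ell, d))%N.
have uE_Om x : Om x -> feval u x = net x.
  by move=> Omx; apply: uE; exact: subset_closure.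
have r_n z : (r z <= ell - d)%N by rewrite /r; case: ifP; lia.
have netP z b : z \in zs -> (\sum_k b k <= r z)%N ->
    partials (index_word b) net z = y z b.
  move=> zzs br; rewrite -W2P // (partials_network _ _ _ sC); last first.
    by rewrite size_index_word (leq_trans br).
  congr (_ *m _); apply/colP => j; rewrite [LHS]mxE [RHS]mxE size_index_word.
  rewrite -prod_index_word [(const_mx a) j 0]mxE; congr (_ * _).
  by apply: eq_bigr => k _; rewrite mxE.
have F_zero z : z \in Oh -> feval (calF u) z = 0.
  move=> /imfsetP[i _ ->]; have [F FP] := calF_local.
  rewrite FP // -(Fhat _ (zF_in i)) FP //; congr (F _ _).
  apply/funext => beta; rewrite /interior_jet /Dmulti.
  rewrite (partials_eq_open oOm uE_Om _ (zF_in i)).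
  rewrite -/(index_word (val beta)) netP; first by rewrite /y asboolT.
    by rewrite mem_undup mem_cat codom_f.
  by rewrite rF_in //; exact: (valP beta).
have B_zero z : z \in Gh -> feval (calB u) z = 0.
  move=> /imfsetP[i _ ->]; have [B BP] := calB_local.
  rewrite BP // -(Bhat _ (zB_in i)) BP //; congr (B _ _).
  apply/funext => beta; rewrite /boundary_jet /Dmulti -/(index_word (val beta)).
  have beta_r : (\sum_k val beta k <= r (zB i))%N.
    by rewrite rB_in //; exact: (valP beta).
  have word_n : (size (index_word (val beta)) <= ell - d)%N.
    by rewrite size_index_word (leq_trans beta_r).
  rewrite (@lim_within_eq_open _ _ _ _ _ (partials (index_word (val beta)) net)).
  - rewrite netP //; last by rewrite mem_undup mem_cat codom_f orbT.
    by rewrite /y asboolF //; exact: Ga_notin.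
  - exact: Ga_cl.
  - by move=> x; exact: partials_eq_open.
  - exact: (continuous_partials_network sC word_n).
have Ju : J u = 0.
  have nu0 : nu != 0 by rewrite gt_eqF // (lt_le_trans ltr01).
  rewrite /J /ad_pinn aDE mul0r addr0 !big_seq !big1 ?mulr0 ?addr0 // => z.
    by move=> /B_zero ->; rewrite lnorm0_powR // mulr0.
  by move=> /F_zero ->; rewrite lnorm0_powR // mulr0.
exists u; split; [by exists net | split | exact: Ju].
  by exists net => //; exists (c * 'C(ell, d))%N.
by move=> v _; rewrite Ju; exact: ad_pinn_ge0.
Qed.
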